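(* Let $X$ and $Y$ be two real-valued random variables defined on the same probability space. Then for any $-\infty<a\le b<\infty$, $$\mathbb{P}(a\le X\le b)\le \frac12\bigl(1+\mathbb{P}(|X-Y|\le b-a)+d_{\mathrm{TV}}(\mathcal{L}_X,\mathcal{L}_Y)\bigr).$$
   Context: $\mathcal{L}_X$ and $\mathcal{L}_Y$ denote the laws of $X$ and $Y$. The total variation distance between two probability measures $\mu,\nu$ on the same measurable space is $d_{\mathrm{TV}}(\mu,\nu)=\sup_A|\mu(A)-\nu(A)|$, the supremum being over measurable sets $A$. *)

(* Defs.v *)
From HB Require Import structures.
From mathcomp Require Import all_boot all_order all_algebra.
From mathcomp Require Import all_classical all_reals all_analysis.

Set Implicit Arguments.
Unset Strict Implicit.
Unset Printing Implicit Defensive.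

Import Order.TTheory GRing.Theory Num.Theory.

Local Open Scope classical_set_scope.
Local Open Scope ring_scope.
Local Open Scope ereal_scope.

(* No factor 2: the distance ranges over [0, 1], not [0, 2]. It is extended-real
   valued, like the measures themselves. *)
Definition d_TV (d : measure_display) (T : measurableType d) (R : realType)
    (mu nu : probability T R) : \bar R :=
  ereal_sup [set `|mu A - nu A| | A in measurable].

(* Main.v *)
Require Import Defs.
From HB Require Import structures.
From mathcomp Require Import all_boot all_order all_algebra.
From mathcomp Require Import all_classical all_reals all_analysis.

Import Order.TTheory GRing.Theory Num.Theory.

Local Open Scope classical_set_scope.
Local Open Scope ring_scope.
Local Open Scope ereal_scope.

(** Let [A] and [B] be the events that [X], respectively [Y], lies in the
    interval from [a] to [b]. On the intersection of [A] and [B] the two values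
    lie in one interval of length [b - a], so they are within [b - a] of each
    other; hence [P A + P B] exceeds [1] by at most the probability of this
    closeness ([probability_add_le]). Moreover [P A] and [P B] are the masses
    that the laws of [X] and [Y] give to the same Borel set, so [P A] exceeds
    [P B] by at most the total variation distance ([probability_le_d_TV]).
    Adding the two bounds controls [2 * P A]. *)

Lemma probability_le_d_TV (d : measure_display) (T : measurableType d)
    (R : realType) (mu nu : probability T R) (A : set T) :
  measurable A -> mu A <= nu A + d_TV mu nu.
Proof.
move=> mA; rewrite -leeBlDl ?fin_num_measure//.
by apply: le_trans (lee_abs _) _; apply: ereal_sup_ubound; exists A.
Qed.

(** By inclusion-exclusion the left-hand side is the probability of the union,
    at most [1], plus that of the intersection, at most [P C]. *)
Lemma probability_add_le (d : measure_display) (T : measurableType d)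
    (R : realType) (P : probability T R) (A B C : set T) :
  measurable A -> measurable B -> measurable C -> A `&` B `<=` C ->
  P A + P B <= 1 + P C.
Proof.
move=> mA mB mC ABC.
have mDAB : measurable (A `\` B) by exact: measurableD.
rewrite (measureDI P mA mB) addeAC; apply: leeD; last first.
  by apply: le_measure => //; rewrite inE//; exact: measurableI.
rewrite -measureU// ?probability_le1//; first exact: measurableU.
by apply/seteqP; split=> // t [[_ nBt] /nBt].
Qed.

Theorem lemma1p2 (R : realType) (d : measure_display) (T : measurableType d)
    (P : probability T R) (X Y : {RV P >-> R}) (a b : R) (hab : (a <= b)%R) :
  P [set t | (a <= X t <= b)%R] <=
  (2^-1)%:E * (1 + P [set t | (`|X t - Y t| <= b - a)%R]
                 + d_TV (distribution P X) (distribution P Y)).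
Proof.
set C := [set t | (`|X t - Y t| <= b - a)%R].
have preimE (Z : {RV P >-> R}) :
    [set t | (a <= Z t <= b)%R] = Z @^-1` `[a, b]%classic.
  by apply/seteqP; split=> t /=; rewrite in_itv.
have mpreim (Z : {RV P >-> R}) : measurable (Z @^-1` `[a, b]%classic).
  by apply: measurable_funPTI.
have mC : measurable C.
  rewrite -[C]setTI; apply: measurable_fun_le => //.
  by apply: measurableT_comp => //; exact: measurable_realfun.measurable_funB.
have XYC : X @^-1` `[a, b]%classic `&` Y @^-1` `[a, b]%classic `<=` C.
  move=> t; rewrite /C /= !in_itv/= => -[/andP[aX Xb] /andP[aY Yb]].
  by rewrite ler_norml opprB !lerB.
rewrite preimE lee_pdivlMl// mule_natl mule2n.
have := probability_le_d_TV _ _ _ (distribution P X) (distribution P Y)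
  _ (measurable_itv `[a, b]).
move/(leeD2l (P (X @^-1` `[a, b]%classic)))/le_trans; apply.
by rewrite addeA leeD2r// probability_add_le.
Qed.
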